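(* Let $X$ be a set of cardinality greater than $1$. Then the category $r\mathcal{G}_{\underline{\Pi}_X}$ of reflexive $\underline{\Pi}_X$-graphs does not have exponentials, i.e. there are objects $G,H$ for which no exponential object $G^H$ exists.
   Context: For a set $X$, the symmetric $X$-power functor $\underline{\Pi}_X:\mathbf{Set}\to\mathbf{Set}$ sends a set $Y$ to the quotient of $Y^X$ by the action of the group $\mathrm{Aut}(X)$ of bijections of $X$ by permutation of coordinates ($g\sim g\circ\sigma$), and acts on maps by post-composition. Let $\eta:\mathrm{Id}_{\mathbf{Set}}\Rightarrow\underline{\Pi}_X$ be the natural transformation sending $y\in Y$ to the class of the constant family $(y)_{x\in X}$. An object of $r\mathcal{G}_{\underline{\Pi}_X}$ is a triple $G=(G(P),G(V),\partial_G)$ with $G(P)$ a set (of parts), $G(V)\subseteq G(P)$ a subset (of vertices) and $\partial_G:G(P)\to\underline{\Pi}_X(G(V))$ a map whose restriction to $G(V)$ is $\eta_{G(V)}$. A morphism $f:G\to H$ is a map $f_P:G(P)\to H(P)$ that restricts to a map $f_V:G(V)\to H(V)$ and satisfies $\partial_H\circ f_P=\underline{\Pi}_X(f_V)\circ\partial_G$. *)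

(* Defs.v *)
From mathcomp Require Import all_boot.
From mathcomp Require Import boolp classical_sets.

Set Implicit Arguments.
Unset Strict Implicit.
Unset Printing Implicit Defensive.

Local Open Scope classical_set_scope.

Record category := Category {
  obj :> Type;
  hom : obj -> obj -> Type;
  idm : forall A, hom A A;
  compm : forall A B C, hom B C -> hom A B -> hom A C;
  comp_idl : forall A B (f : hom A B), compm (idm B) f = f;
  comp_idr : forall A B (f : hom A B), compm f (idm A) = f;
  comp_assoc : forall A B C D (h : hom C D) (g : hom B C) (f : hom A B),
    compm h (compm g f) = compm (compm h g) f
}.

Arguments hom {_} _ _.
Arguments idm {_} _.
Arguments compm {_ _ _ _} _ _.

Record product (C : category) (A B : C) := Product {
  prod_obj :> C;
  pr1 : hom prod_obj A;
  pr2 : hom prod_obj B;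
  pairing : forall K : C, hom K A -> hom K B -> hom K prod_obj;
  pr1_pairing : forall (K : C) (a : hom K A) (b : hom K B),
    compm pr1 (pairing a b) = a;
  pr2_pairing : forall (K : C) (a : hom K A) (b : hom K B),
    compm pr2 (pairing a b) = b;
  pairing_uniq : forall (K : C) (u : hom K prod_obj),
    pairing (compm pr1 u) (compm pr2 u) = u
}.

Arguments pr1 {C A B} _.
Arguments pr2 {C A B} _.
Arguments pairing {C A B} _ {K} _ _.

(* E is an exponential object G ^ H: the morphism
   pairing EH (compm g (pr1 KH)) (pr2 KH) is g x id_H. Products are given by
   their universal property, so the choice of EH and KH is immaterial. *)
Definition is_exponential (C : category) (G H E : C) : Prop :=
  exists (EH : product E H) (ev : hom EH G),
    forall (K : C) (KH : product K H) (f : hom KH G),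
      exists! g : hom K E, compm ev (pairing EH (compm g (pr1 KH)) (pr2 KH)) = f.

Section SymmetricPower.
Variable X : Type.

Definition sym_orbit (Y : Type) (g : X -> Y) : set (X -> Y) :=
  [set g \o s | s in [set s : X -> X | bijective s]].

(* The quotient of Y ^ X by Aut(X), as the set of orbits. *)
Definition sym_pow (Y : Type) : Type := range (@sym_orbit Y).

Lemma sym_class_subproof (Y : Type) (g : X -> Y) :
  sym_orbit g \in range (@sym_orbit Y).
Proof. by apply/mem_set; exists g. Qed.

Definition sym_class (Y : Type) (g : X -> Y) : sym_pow Y :=
  exist _ (sym_orbit g) (sym_class_subproof g).

Lemma sym_orbit_comp (Y Z : Type) (f : Y -> Z) (g : X -> Y) :
  [set f \o h | h in sym_orbit g] = sym_orbit (f \o g).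
Proof.
apply/seteqP; split=> [_ [_ [s bs <-] <-]|_ [s bs <-]]; first by exists s.
by exists (g \o s) => //; exists s.
Qed.

Lemma sym_map_subproof (Y Z : Type) (f : Y -> Z) (A : sym_pow Y) :
  [set f \o h | h in \val A] \in range (@sym_orbit Z).
Proof.
by case: A => _ /= /set_mem[g _ <-]; rewrite sym_orbit_comp sym_class_subproof.
Qed.

Definition sym_map (Y Z : Type) (f : Y -> Z) (A : sym_pow Y) : sym_pow Z :=
  exist _ [set f \o h | h in \val A] (sym_map_subproof f A).

Lemma sym_classP (Y : Type) (A : sym_pow Y) : exists g, A = sym_class g.
Proof. by case: (set_mem (valP A)) => g _ gA; exists g; apply: val_inj. Qed.

Lemma sym_class_eq (Y : Type) (g h : X -> Y) :
  sym_class g = sym_class h <-> exists2 s : X -> X, bijective s & g \o s = h.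
Proof.
split=> [[gh]|[s [t st ts] <-]].
  have : sym_orbit h h by exists id => //; exists id.
  by rewrite -gh => -[s bs <-]; exists s.
apply: val_inj => /=; apply/seteqP; split=> _ [r br <-].
  exists (t \o r); first by apply: bij_comp => //; exists s.
  by apply/funext => x /=; rewrite ts.
by exists (s \o r) => //; apply: bij_comp => //; exists t.
Qed.

Lemma sym_mapE (Y Z : Type) (f : Y -> Z) (g : X -> Y) :
  sym_map f (sym_class g) = sym_class (f \o g).
Proof. by apply: val_inj; exact: sym_orbit_comp. Qed.

Lemma sym_map_id (Y : Type) (A : sym_pow Y) : sym_map id A = A.
Proof. by have [g ->] := sym_classP A; rewrite sym_mapE. Qed.

Lemma sym_map_comp (Y Z W : Type) (f : Z -> W) (g : Y -> Z) (A : sym_pow Y) :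
  sym_map (f \o g) A = sym_map f (sym_map g A).
Proof. by have [h ->] := sym_classP A; rewrite !sym_mapE. Qed.

Definition sym_eta (Y : Type) (y : Y) : sym_pow Y := sym_class (fun=> y).

Lemma sym_eta_nat (Y Z : Type) (f : Y -> Z) (y : Y) :
  sym_map f (sym_eta y) = sym_eta (f y).
Proof. by rewrite /sym_eta sym_mapE. Qed.

End SymmetricPower.

Record reflgraph (X : Type) := ReflGraph {
  part : Type;
  vert : set part;
  bd : part -> sym_pow X vert;
  bd_vert : forall v : vert, bd (\val v) = sym_eta X v
}.

Arguments part {X} _.
Arguments vert {X} _.
Arguments bd {X} _ _.

Section Restriction.
Variables (S T : Type) (A : set S) (B : set T).

Lemma restr_subproof (f : S -> T) (fAB : forall x, A x -> B (f x)) (v : A) :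
  f (\val v) \in B.
Proof. by apply/mem_set/fAB/set_mem/valP. Qed.

Definition restr (f : S -> T) (fAB : forall x, A x -> B (f x)) (v : A) : B :=
  exist _ (f (\val v)) (restr_subproof fAB v).

End Restriction.

Record reflgraph_hom (X : Type) (G H : reflgraph X) := ReflGraphHom {
  hom_part : part G -> part H;
  hom_vert : forall p, vert G p -> vert H (hom_part p);
  hom_bd : forall p, bd H (hom_part p) = sym_map (restr hom_vert) (bd G p)
}.

Section ReflGraphCategory.
Variable X : Type.
Implicit Types G H K : reflgraph X.

Lemma reflgraph_hom_eq G H (f g : reflgraph_hom G H) :
  hom_part f = hom_part g -> f = g.
Proof.
case: f g => [f fv fb] [g gv gb] /= fg; subst g.
have ? : fv = gv by exact: Prop_irrelevance.
by subst gv; congr ReflGraphHom; exact: Prop_irrelevance.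
Qed.

Lemma reflgraph_id_bd G (idv : forall p, vert G p -> vert G p) (p : part G) :
  bd G p = sym_map (@restr _ _ (vert G) (vert G) id idv) (bd G p).
Proof.
rewrite -[LHS]sym_map_id; congr sym_map.
by apply/funext => v; apply: val_inj.
Qed.

Definition reflgraph_id G : reflgraph_hom G G :=
  ReflGraphHom (reflgraph_id_bd (fun p (vp : vert G p) => vp)).

Definition reflgraph_comp_vert G H K (g : reflgraph_hom H K) (f : reflgraph_hom G H) p
    (vp : vert G p) : vert K ((hom_part g \o hom_part f) p) :=
  hom_vert g (hom_vert f vp).

Lemma reflgraph_comp_bd G H K (g : reflgraph_hom H K) (f : reflgraph_hom G H) p :
  bd K ((hom_part g \o hom_part f) p) =
  sym_map (restr (@reflgraph_comp_vert _ _ _ g f)) (bd G p).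
Proof.
rewrite /= hom_bd hom_bd -sym_map_comp; congr sym_map.
by apply/funext => v; apply: val_inj.
Qed.

Definition reflgraph_comp G H K (g : reflgraph_hom H K) (f : reflgraph_hom G H) :
    reflgraph_hom G K :=
  ReflGraphHom (reflgraph_comp_bd g f).

Definition reflgraph_cat : category.
Proof.
by refine (@Category (reflgraph X) (@reflgraph_hom X) reflgraph_id reflgraph_comp _ _ _);
  move=> *; apply: reflgraph_hom_eq.
Defined.

End ReflGraphCategory.

(* Main.v *)
Require Import Defs.
From mathcomp Require Import all_boot.
From mathcomp Require Import boolp classical_sets.

(** If an exponential [G ^ H] exists, then [Hom (- * H, G)] is representable,
    hence turns every colimit that exists into a limit. The functor [- * H]
    itself does not preserve coequalizers, because the symmetric power does not
    preserve products: a part of [G * H] over a pair of parts [(p, q)] is a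
    choice of a class in [Pi_X (V_G * V_H)] that lies over [bd p] and [bd q],
    and there may be several.

    Let [I] be the interval, with two vertices [0], [1] and one further part
    [e], whose boundary takes one value at [x0] and the other value elsewhere.
    Over [(e, e)] the graph [I * I] has the [diagonal] part, with boundary
    [x |-> (g x, g x)], and the [twisted] part, with boundary
    [x |-> (g x, g (s x))] where [s] exchanges [x0] and [x1]. When the two ends
    of the first factor are glued, both boundaries become
    [x |-> (v, g x)] up to a permutation of [X], so the two parts are glued as
    well. Now let [G] have one vertex and one further part, and let
    [f : I * I -> G] send the diagonal part to that part and everything else,
    in particular the twisted part, to the vertex. The restrictions of [f] to [{0} * I] and [{1} * I]
    agree, so a transpose [I -> G ^ I] of [f] would identify the two ends of
    [I] ([transpose_coequalizes]); a product of morphisms whose first factor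
    identifies the ends cannot separate the two parts
    ([glued_ends_glue_diagonal]), and neither can [f]. *)

Set Implicit Arguments.
Unset Strict Implicit.
Unset Printing Implicit Defensive.

Local Open Scope classical_set_scope.

(** * Products and exponentials in a category *)

Section Category.
Variable C : category.

Lemma pairing_comp (A B K L : C) (P : product A B) (a : hom K A) (b : hom K B)
    (h : hom L K) :
  compm (pairing P a b) h = pairing P (compm a h) (compm b h).
Proof.
by rewrite -[LHS]pairing_uniq !comp_assoc pr1_pairing pr2_pairing.
Qed.

Definition times_id (H K L : C) (KH : product K H) (LH : product L H)
    (h : hom K L) : hom (prod_obj KH) (prod_obj LH) :=
  pairing LH (compm h (pr1 KH)) (pr2 KH).

Lemma times_id_comp (H K L M : C) (KH : product K H) (LH : product L H)
    (MH : product M H) (g : hom L M) (h : hom K L) :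
  times_id KH MH (compm g h) = compm (times_id LH MH g) (times_id KH LH h).
Proof.
by rewrite /times_id pairing_comp -!comp_assoc pr1_pairing pr2_pairing.
Qed.

(** Both composites [t \o h] and [t \o h'] are transposes of one morphism. *)
Lemma transpose_coequalizes (G H E : C) (EH : product E H)
    (ev : hom (prod_obj EH) G)
    (evP : forall (K : C) (KH : product K H) (f : hom (prod_obj KH) G),
      exists! g : hom K E, compm ev (times_id KH EH g) = f)
    (K L : C) (KH : product K H) (LH : product L H) (t : hom L E)
    (h h' : hom K L) :
  compm (compm ev (times_id LH EH t)) (times_id KH LH h) =
    compm (compm ev (times_id LH EH t)) (times_id KH LH h') ->
  compm t h = compm t h'.
Proof.
rewrite -!comp_assoc -!times_id_comp => hh'.
have [g [_ g_uniq]] := evP _ KH (compm ev (times_id KH EH (compm t h'))).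
by rewrite -(g_uniq _ hh') -(g_uniq _ erefl).
Qed.

End Category.

(** * Products of reflexive graphs *)

Section Product.
Variable X : Type.

Lemma sym_pow_const (Y : Type) (y : Y) (A : sym_pow X Y) :
  (forall z, z = y) -> A = sym_eta X y.
Proof.
by move=> Yy; have [g ->] := sym_classP A; congr sym_class; apply/funext.
Qed.

Lemma sym_class_eta (Y : Type) (g : X -> Y) (y : Y) :
  sym_class g = sym_eta X y -> g = fun=> y.
Proof.
move=> /esym/sym_class_eq[s _ gE].
by rewrite -gE.
Qed.

Lemma sym_eta_pair (Y Z : Type) (A : sym_pow X (Y * Z)) (y : Y) (z : Z) :
  sym_map fst A = sym_eta X y -> sym_map snd A = sym_eta X z ->
  A = sym_eta X (y, z).
Proof.
have [g ->] := sym_classP A; rewrite !sym_mapE.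
move=> g1 g2; congr sym_class; apply/funext => x.
rewrite [LHS]surjective_pairing; congr pair.
- by have /(congr1 (@^~ x)) := sym_class_eta g1.
- by have /(congr1 (@^~ x)) := sym_class_eta g2.
Qed.

Variables G H : reflgraph X.

(** A part of a graph over [G] and [H] has a boundary in [Pi_X (V_G * V_H)]
    which its images in [Pi_X V_G] and [Pi_X V_H] do not determine, so the
    universal property forces this joint boundary to be part of the data. *)
Record prod_part := ProdPart {
  part1 : part G;
  part2 : part H;
  joint_bd : sym_pow X (vert G * vert H);
  joint_bd1 : sym_map fst joint_bd = bd G part1;
  joint_bd2 : sym_map snd joint_bd = bd H part2
}.

Lemma prod_part_eq (s t : prod_part) :
  part1 s = part1 t -> part2 s = part2 t -> joint_bd s = joint_bd t -> s = t.
Proof.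
case: s t => [p q A A1 A2] [p' q' A' A1' A2'] /= ? ? ?; subst p' q' A'.
by congr ProdPart; exact: Prop_irrelevance.
Qed.

Definition prod_vert : set prod_part :=
  [set t | vert G (part1 t) /\ vert H (part2 t)].

Lemma vertex_pair_bd1 (u : vert G * vert H) :
  sym_map fst (sym_eta X u) = bd G (\val u.1).
Proof. by rewrite sym_eta_nat bd_vert. Qed.

Lemma vertex_pair_bd2 (u : vert G * vert H) :
  sym_map snd (sym_eta X u) = bd H (\val u.2).
Proof. by rewrite sym_eta_nat bd_vert. Qed.

Definition vertex_pair_part (u : vert G * vert H) : prod_part :=
  ProdPart (vertex_pair_bd1 u) (vertex_pair_bd2 u).

Lemma vertex_pair_in (u : vert G * vert H) : vertex_pair_part u \in prod_vert.
Proof. by apply/mem_set; split; apply/set_mem/valP. Qed.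

Definition vertex_pair (u : vert G * vert H) : prod_vert :=
  exist _ (vertex_pair_part u) (vertex_pair_in u).

Lemma prod_vert1 (t : prod_part) : prod_vert t -> vert G (part1 t).
Proof. by case. Qed.

Lemma prod_vert2 (t : prod_part) : prod_vert t -> vert H (part2 t).
Proof. by case. Qed.

Definition pair_of_vertex (v : prod_vert) : vert G * vert H :=
  (restr prod_vert1 v, restr prod_vert2 v).

Lemma vertex_pairK : cancel vertex_pair pair_of_vertex.
Proof. by case=> v w; congr pair; apply: val_inj. Qed.

(** Over a pair of vertices the joint boundary is forced to be constant. *)
Lemma joint_bd_vertex (v : prod_vert) :
  joint_bd (\val v) = sym_eta X (pair_of_vertex v).
Proof.
apply: sym_eta_pair; first by rewrite joint_bd1 -bd_vert.
by rewrite joint_bd2 -bd_vert.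
Qed.

Lemma pair_of_vertexK : cancel pair_of_vertex vertex_pair.
Proof.
by move=> v; apply: val_inj; apply: prod_part_eq => //=; rewrite joint_bd_vertex.
Qed.

Lemma prod_bd_vert (v : prod_vert) :
  sym_map vertex_pair (joint_bd (\val v)) = sym_eta X v.
Proof. by rewrite joint_bd_vertex sym_eta_nat pair_of_vertexK. Qed.

Definition prod_graph : reflgraph X :=
  @ReflGraph X prod_part prod_vert (fun t => sym_map vertex_pair (joint_bd t))
    prod_bd_vert.

Lemma prod_pr1_bd (t : part prod_graph) :
  bd G (part1 t) = sym_map (restr prod_vert1) (bd prod_graph t).
Proof.
rewrite /= -sym_map_comp -joint_bd1; congr sym_map.
by apply/funext => u; apply: val_inj.
Qed.

Lemma prod_pr2_bd (t : part prod_graph) :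
  bd H (part2 t) = sym_map (restr prod_vert2) (bd prod_graph t).
Proof.
rewrite /= -sym_map_comp -joint_bd2; congr sym_map.
by apply/funext => u; apply: val_inj.
Qed.

Definition prod_pr1 : reflgraph_hom prod_graph G := ReflGraphHom prod_pr1_bd.
Definition prod_pr2 : reflgraph_hom prod_graph H := ReflGraphHom prod_pr2_bd.

Section Pairing.
Variables (K : reflgraph X) (a : reflgraph_hom K G) (b : reflgraph_hom K H).

Definition vert_pairing (v : vert K) : vert G * vert H :=
  (restr (hom_vert a) v, restr (hom_vert b) v).

Lemma pairing_bd1 (p : part K) :
  sym_map fst (sym_map vert_pairing (bd K p)) = bd G (hom_part a p).
Proof. by rewrite -sym_map_comp hom_bd. Qed.

Lemma pairing_bd2 (p : part K) :
  sym_map snd (sym_map vert_pairing (bd K p)) = bd H (hom_part b p).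
Proof. by rewrite -sym_map_comp hom_bd. Qed.

Definition pairing_part (p : part K) : part prod_graph :=
  ProdPart (pairing_bd1 p) (pairing_bd2 p).

Lemma pairing_vert (p : part K) : vert K p -> vert prod_graph (pairing_part p).
Proof. by move=> Kp; split; exact: hom_vert. Qed.

Lemma pairing_bd (p : part K) :
  bd prod_graph (pairing_part p) = sym_map (restr pairing_vert) (bd K p).
Proof.
rewrite /= -sym_map_comp; congr sym_map; apply/funext => v.
apply: val_inj; apply: prod_part_eq => //=.
by rewrite bd_vert sym_eta_nat.
Qed.

Definition prod_pairing : reflgraph_hom K prod_graph := ReflGraphHom pairing_bd.

End Pairing.

Lemma prod_pairing_uniq (K : reflgraph X) (u : reflgraph_hom K prod_graph) :
  prod_pairing (reflgraph_comp prod_pr1 u) (reflgraph_comp prod_pr2 u) = u.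
Proof.
apply: reflgraph_hom_eq; apply/funext => p; apply: prod_part_eq => //=.
have -> : joint_bd (hom_part u p) =
    sym_map pair_of_vertex (bd prod_graph (hom_part u p)).
  rewrite /= -sym_map_comp -[LHS]sym_map_id; congr sym_map.
  by apply/funext => w; rewrite /= vertex_pairK.
rewrite hom_bd -sym_map_comp; congr sym_map; apply/funext => v.
by congr pair; apply: val_inj.
Qed.

Definition reflgraph_product : @product (reflgraph_cat X) G H.
Proof.
refine (@Product (reflgraph_cat X) G H prod_graph prod_pr1 prod_pr2 prod_pairing
  _ _ prod_pairing_uniq).
- by move=> K a b; apply: reflgraph_hom_eq.
- by move=> K a b; apply: reflgraph_hom_eq.
Defined.

End Product.

(** * The interval and the loop *)

Section Interval.
Variables (X : Type) (x0 x1 : X).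
Hypothesis x01 : x0 <> x1.

Definition interval_vert : set (option bool) := range Some.

Lemma interval_end_in (c : bool) : Some c \in interval_vert.
Proof. by apply/mem_set; exists c. Qed.

Definition interval_end (c : bool) : interval_vert :=
  exist _ (Some c) (interval_end_in c).

Definition edge_bd (x : X) : interval_vert := interval_end `[< x = x0 >].

Definition interval_bd (p : option bool) : sym_pow X interval_vert :=
  if p is Some c then sym_eta X (interval_end c) else sym_class edge_bd.

Lemma interval_bd_vert (v : interval_vert) :
  interval_bd (\val v) = sym_eta X v.
Proof.
have [c _ cv] := set_mem (valP v).
by rewrite -cv; congr sym_eta; apply: val_inj.
Qed.

Definition interval : reflgraph X := ReflGraph interval_bd_vert.

Lemma const_end_bd (c : bool)
    (cv : forall p, vert interval p -> vert interval (Some c)) p :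
  bd interval (Some c) = sym_map (restr cv) (bd interval p).
Proof.
have [g ->] := sym_classP (bd interval p); rewrite sym_mapE.
by congr sym_class; apply/funext => x; apply: val_inj.
Qed.

(** These endomorphisms stand for the inclusions of the two ends: they factor
    through them, and composing with them detects where the ends go. *)
Definition const_end (c : bool) : reflgraph_hom interval interval :=
  ReflGraphHom (@const_end_bd c (fun _ _ => set_mem (interval_end_in c))).

Lemma loop_vertex_in : false \in [set false].
Proof. exact/mem_set. Qed.

Definition loop_vertex : [set false] := exist _ false loop_vertex_in.

Lemma loop_vertex_only (v : [set false]) : v = loop_vertex.
Proof. by apply: val_inj; exact: set_mem (valP v). Qed.

Lemma loop_bd_vert (v : [set false]) : sym_eta X loop_vertex = sym_eta X v.
Proof. by rewrite (loop_vertex_only v). Qed.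

Definition loop : reflgraph X :=
  @ReflGraph X bool [set false] (fun=> sym_eta X loop_vertex) loop_bd_vert.

(** A morphism to the loop is a set of parts that contains no vertex: the
    boundary condition holds automatically over a single vertex. *)
Lemma to_loop_bd (G : reflgraph X) (f : part G -> bool)
    (fv : forall p, vert G p -> vert loop (f p)) p :
  bd loop (f p) = sym_map (restr fv) (bd G p).
Proof. by apply/esym/sym_pow_const; exact: loop_vertex_only. Qed.

Definition swap (x : X) : X :=
  if `[< x = x0 >] then x1 else if `[< x = x1 >] then x0 else x.

Lemma swap0 : swap x0 = x1.
Proof. by rewrite /swap asboolT. Qed.

Lemma swap1 : swap x1 = x0.
Proof. by rewrite /swap asboolF ?asboolT //; apply/nesym. Qed.

Lemma swapK : involutive swap.
Proof.
move=> x; have [->|xx0] := pselect (x = x0); first by rewrite swap0 swap1.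
have [->|xx1] := pselect (x = x1); first by rewrite swap1 swap0.
by have xE : swap x = x; [rewrite /swap !asboolF | rewrite !xE].
Qed.

Lemma swap_bij : bijective swap.
Proof. exact: inv_bij swapK. Qed.

Definition diagonal_bd : sym_pow X (vert interval * vert interval) :=
  sym_class (fun x => (edge_bd x, edge_bd x)).

Definition twisted_bd : sym_pow X (vert interval * vert interval) :=
  sym_class (fun x => (edge_bd x, edge_bd (swap x))).

Lemma diagonal_bd1 : sym_map fst diagonal_bd = bd interval None.
Proof. by rewrite sym_mapE. Qed.

Lemma diagonal_bd2 : sym_map snd diagonal_bd = bd interval None.
Proof. by rewrite sym_mapE. Qed.

Lemma twisted_bd1 : sym_map fst twisted_bd = bd interval None.
Proof. by rewrite sym_mapE. Qed.

Lemma twisted_bd2 : sym_map snd twisted_bd = bd interval None.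
Proof.
by rewrite sym_mapE; apply/esym/sym_class_eq; exists swap => //; exact: swap_bij.
Qed.

Definition diagonal : prod_part interval interval :=
  ProdPart diagonal_bd1 diagonal_bd2.

Definition twisted : prod_part interval interval :=
  ProdPart twisted_bd1 twisted_bd2.

(** Every value of the diagonal boundary has equal coordinates, the value of
    the twisted boundary at [x0] has not. *)
Lemma twisted_neq_diagonal : twisted_bd <> diagonal_bd.
Proof.
move=> /esym/sym_class_eq[s _ /(congr1 (@^~ x0))/= [-> ]].
by rewrite swap0 asboolT // asboolF //; apply/nesym.
Qed.

(** The test on the first projection is what makes the two restrictions to
    [{0} * I] and [{1} * I] agree: both are constant. *)
Definition is_diagonal (t : prod_part interval interval) : bool :=
  `[< part1 t = None /\ joint_bd t = diagonal_bd >].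

Lemma is_diagonal_vert (t : part (prod_graph interval interval)) :
  vert (prod_graph interval interval) t -> vert loop (is_diagonal t).
Proof. by case=> -[c _ ct] _; apply: asboolF; rewrite -ct => -[]. Qed.

Definition diagonal_test : reflgraph_hom (prod_graph interval interval) loop :=
  ReflGraphHom (to_loop_bd is_diagonal_vert).

Let C : category := reflgraph_cat X.
Let I : C := interval.
Let II : product I I := reflgraph_product interval interval.

(** If [t] identifies the ends of the interval, the joint boundaries in [E * I]
    become [x |-> (v, edge_bd x)] and [x |-> (v, edge_bd (swap x))], which
    differ by the permutation [swap]. An arbitrary product [EH] receives its
    morphism from the concrete product, in which parts are explicit. *)
Lemma glued_ends_glue_diagonal (E : C) (EH : product E I) (t : hom I E) :
  hom_part t (Some false) = hom_part t (Some true) ->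
  hom_part (times_id II EH t) diagonal = hom_part (times_id II EH t) twisted.
Proof.
move=> t_ends; pose EI : product E I := reflgraph_product E interval.
have -> : times_id II EH t =
    compm (pairing EH (pr1 EI) (pr2 EI)) (times_id II EI t).
  by rewrite pairing_comp pr1_pairing pr2_pairing.
congr (hom_part (pairing EH (pr1 EI) (pr2 EI)) _).
apply: prod_part_eq => //=; rewrite -!sym_map_comp !sym_mapE.
apply/sym_class_eq; exists swap; first exact: swap_bij.
have t_end c c' : hom_part t (Some c) = hom_part t (Some c').
  by case: c c' => [] [].
apply/funext => x; congr pair; apply: val_inj => //=; exact: t_end.
Qed.

Lemma interval_not_exponent : ~ exists E : C, is_exponential (loop : C) I E.
Proof.
move=> [E [EH [ev evP]]].
have [t [tE _]] := evP _ II diagonal_test.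
have t_ends : compm t (const_end false : hom I I) =
    compm t (const_end true : hom I I).
  apply: (transpose_coequalizes evP (KH := II) (LH := II)).
  (* A part in the image of [const_end c * I] has a vertex as first projection. *)
  rewrite /times_id tE; apply: reflgraph_hom_eq; apply/funext => s /=.
  by rewrite /is_diagonal /= !asboolF // => -[].
have /(glued_ends_glue_diagonal EH) glued :
    hom_part t (Some false) = hom_part t (Some true).
  by have := congr1 (fun h : reflgraph_hom interval E => hom_part h None) t_ends.
have fE s : hom_part ev (hom_part (times_id II EH t) s) = is_diagonal s.
  exact: (congr1 (fun h : reflgraph_hom _ _ => hom_part h s) tE).
have : is_diagonal twisted by rewrite -fE -glued fE; apply/asboolP.
by move=> /asboolP[_ /=]; exact: twisted_neq_diagonal.
Qed.

End Interval.

Theorem corollaryC (X : Type) (hX : exists x y : X, x <> y) :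
  exists G H : reflgraph_cat X,
    ~ exists E : reflgraph_cat X, is_exponential G H E.
Proof.
have [x0 [x1 x01]] := hX.
exists (loop X), (interval x0).
exact: interval_not_exponent x01.
Qed.
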